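(* Let $X, Y$ be two real Banach spaces, $\Phi:X\to Y$ a surjective continuous linear operator, $\Psi:X\to Y$ a non-constant Lipschitzian operator with Lipschitz constant equal to $L$, $\varphi:Y\to \mathbf{R}$ a non-constant, continuous, concave and inf-connected functional, and $[a,b]$ a closed sub-interval of $[-1,1]$. Then, for every continuous and concave function $\gamma:[a,b]\to \mathbf{R}$, one has $$\max\left\{\inf_{x\in X}\varphi\left(\Phi(x)+\frac{a}{\alpha_{\Phi}L}\Psi(x)\right)+\gamma(a),\ \inf_{x\in X}\varphi\left(\Phi(x)+\frac{b}{\alpha_{\Phi}L}\Psi(x)\right)+\gamma(b)\right\}$$ $$=\inf_{x\in X}\sup_{\lambda\in [a,b]}\left(\varphi\left(\Phi(x)+\frac{\lambda}{\alpha_{\Phi}L}\Psi(x)\right)+\gamma(\lambda)\right),$$ where $$\alpha_{\Phi}=\sup_{\|y\|_Y\leq 1}\mathrm{dist}(0,\Phi^{-1}(y)).$$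
   Context: A real-valued function $f$ on a topological space is said to be inf-connected if $f^{-1}(]-\infty,r[)$ is connected for all $r\in \mathbf{R}$ (the empty set counts as connected). The distance $\mathrm{dist}(0,\Phi^{-1}(y))$ is $\inf\{\|x\|_X : x\in X,\ \Phi(x)=y\}$. Infima and suprema are taken in the extended real line, so both sides of the equality may be $-\infty$. The Lipschitz constant of $\Psi$ is the least $L\ge 0$ with $\|\Psi(x)-\Psi(x')\|_Y\le L\|x-x'\|_X$ for all $x,x'\in X$. *)

(* Defs.v *)
From mathcomp Require Import all_boot all_order all_algebra.
From mathcomp Require Import all_classical all_reals all_analysis.
Set Implicit Arguments.
Unset Strict Implicit.
Unset Printing Implicit Defensive.
Import Order.TTheory GRing.Theory Num.Theory.
Import numFieldNormedType.Exports.

Local Open Scope classical_set_scope.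
Local Open Scope ring_scope.

Definition nonconstant (S T : Type) (f : S -> T) : Prop :=
  exists x x' : S, f x <> f x'.

(* [connected set0] holds, so empty sublevel sets are allowed. *)
Definition inf_connected (R : realType) (T : topologicalType) (f : T -> R)
    : Prop :=
  forall r : R, connected (f @^-1` `]-oo, r[).

Definition concave_on (R : realType) (E : lmodType R) (D : set E) (f : E -> R)
    : Prop :=
  convex_function D (fun x => - f x).

Definition is_lipschitz_constant (R : realType) (X Y : normedModType R)
    (f : X -> Y) (L : R) : Prop :=
  [/\ 0 <= L, L.-lipschitz f &
      forall M : R, 0 <= M -> M.-lipschitz f -> L <= M].

Definition dist0 (R : realType) (X : normedModType R) (A : set X) : \bar R :=
  ereal_inf [set `|x|%:E | x in A].

Definition alphaE (R : realType) (X Y : normedModType R) (Phi : X -> Y)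
    : \bar R :=
  ereal_sup [set dist0 (Phi @^-1` [set y]) | y in [set y : Y | `|y| <= 1]].

(* For a surjective continuous linear map between Banach spaces [alphaE Phi] is
   finite by the open mapping theorem, so [fine] does not change its value. *)
Definition alpha (R : realType) (X Y : normedModType R) (Phi : X -> Y) : R :=
  fine (alphaE Phi).

(* Main.v *)
Require Import Defs.
From mathcomp Require Import all_boot all_order all_algebra.
From mathcomp Require Import all_classical all_reals all_analysis.
From mathcomp Require Import ring lra.
Import Order.TTheory GRing.Theory Num.Theory.
Import numFieldNormedType.Exports.

Local Open Scope classical_set_scope.
Local Open Scope ring_scope.

(** For [-1 < l < 1], the map [T_l = Phi + l / (alpha L) Psi] is a perturbation
of [Phi] by a Lipschitz map whose constant is smaller than [1 / alpha].
Successive approximations, run on points and on polygonal paths, show that the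
preimage under [T_l] of every ball is nonempty and path connected; hence [T_l]
pulls connected open sets back to connected sets. As [phi] is concave and not
constant, it is unbounded below, so the sublevel sets of
[f x l = phi (T_l x) + gamma l] in [x] are nonempty and connected.

Now let [r] exceed both values of the left-hand side and suppose that every [x]
has some [m] with [r < f x m]. By concavity in [l], each sublevel set
[f x l < r] splits into the disjoint open sets of those [x] having such an [m]
to the left of [l], resp. to the right; by connectedness one of the two is empty.
Which one is locally constant in [l], but near [a] there is a point of the
second kind and near [b] one of the first kind: a contradiction.

When the denominator [alpha L] is 0, division by zero makes [T_l = Phi], whose
preimages of balls are convex. *)

(** * Concave functions *)

Lemma concave_onP (R : realType) (E : lmodType R) (D : set E) (f : E -> R) :
  concave_on D f <->
  (forall x y t, D x -> D y -> 0 <= t -> t <= 1 ->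
     t * f x + (1 - t) * f y <= f (t *: x + (1 - t) *: y)).
Proof.
split=> [cf x y t Dx Dy t0 t1|cf t x y /set_mem Dx /set_mem Dy].
  have := cf (Itv01 t0 t1) x y (mem_set Dx) (mem_set Dy).
  by rewrite convRE /= !mulrN -opprD lerN2.
by rewrite convRE !mulrN -opprD lerN2 cf.
Qed.

(** Along the ray that starts at [v] and passes through a point [u] of lower value, concavity forces
    at least linear decrease. *)
Lemma concave_nonconstant_unbounded (R : realType) (E : lmodType R)
    (f : E -> R) (r : R) :
  concave_on [set: E] f -> nonconstant f -> exists y, f y < r.
Proof.
move=> cf [u [v fuv]].
wlog fltuv : u v {fuv} / f u < f v.
  by move=> W; have [/W//|/W//|/fuv] := ltgtP (f u) (f v).
apply: contrapT => /forallNP fr.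
have ge_r y : r <= f y by rewrite leNgt; apply/negP.
(* With [r] as a lower bound, concavity gives [f u >= f v - s * (f v - r)]. The [+ 1] in the
   denominator makes the right side equal to [f u + s], a contradiction. *)
pose s := (f v - f u) / (f v - r + 1).
have d0 : 0 < f v - r + 1 by have := ge_r v; lra.
have s0 : 0 < s by rewrite divr_gt0// subr_gt0.
have s1 : s <= 1 by rewrite ler_pdivrMr//; have := ge_r u; lra.
have := (concave_onP _ _ _ _).1 cf (v + s^-1 *: (u - v)) v s Logic.I Logic.I
  (ltW s0) s1.
rewrite [s *: (v + _)]scalerDr scalerA mulfV ?gt_eqF// scale1r scalerBl scale1r.
have -> : s *: v + (u - v) + (v - s *: v) = u.
  by rewrite [s *: v + (u - v)]addrC -addrA [s *: v + _]addrC !subrK.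
have := ge_r (v + s^-1 *: (u - v)).
set w := f _ => rw.
have sE : s * (f v - r + 1) = f v - f u by rewrite divfK ?gt_eqF.
nra.
Qed.

(** * Connectedness through open covers *)

Lemma connected_cover (T : topologicalType) (A U V : set T) :
  connected A -> open U -> open V -> A `<=` U `|` V ->
  A `&` U !=set0 -> A `&` V !=set0 -> A `&` U `&` V !=set0.
Proof.
move=> cA oU oV AUV AU0 [v [Av Vv]]; apply/set0P/eqP => AUV0.
suff AUE : A `&` U = A.
  by have : (A `&` U `&` V) v; [split; rewrite ?AUE|rewrite AUV0].
apply: (cA (A `&` U) AU0); first by exists U.
exists (~` V); first exact: open_closedC.
apply/seteqP; split=> [x AUx|x [Ax nVx]].
  split; first by case: AUx.
  by move=> Vx; have : (A `&` U `&` V) x; [|rewrite AUV0].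
by split=> //; case: (AUV _ Ax).
Qed.

Lemma connected_from_cover (T : topologicalType) (A : set T) :
  (forall U V, open U -> open V -> A `<=` U `|` V ->
     A `&` U !=set0 -> A `&` V !=set0 -> A `&` U `&` V !=set0) ->
  connected A.
Proof.
move=> cA B B0 [U oU BU] [C cC BC]; rewrite BU.
apply/seteqP; split=> [x []//|x Ax].
apply: contrapT => nAUx.
have [|||y [[Ay Uy] nCy]] := cA U (~` C) oU (closed_openC cC).
- move=> y Ay; have [Cy|Cy] := pselect (C y); last by right.
  by left; have [] : (A `&` U) y by rewrite -BU BC.
- by rewrite -BU.
- by exists x; split=> // Cx; apply: nAUx; rewrite -BU BC.
- by have [_] : (A `&` C) y by rewrite -BC BU.
Qed.

(** The preimage of a small ball is connected, so it lies on one side of any open splitting of the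
    preimage of [C]. Sorting the points of [C] by that side would split [C] itself. *)
Lemma connected_preimage_open (R : realType) (X : topologicalType)
    (Y : normedModType R) (T : X -> Y) (C : set Y) :
  continuous T -> open C -> connected C ->
  (forall y (e : R), 0 < e -> connected (T @^-1` ball y e)) ->
  (forall y (e : R), 0 < e -> T @^-1` ball y e !=set0) ->
  connected (T @^-1` C).
Proof.
move=> cT oC cC cTb Tb0; apply: connected_from_cover => U V oU oV TUV TU TV.
apply: contrapT => TUV0.
have sides y : C y -> exists2 e : R, 0 < e & ball y e `<=` C /\
    (T @^-1` ball y e `<=` U \/ T @^-1` ball y e `<=` V).
  move=> Cy; have /nbhs_ballP[e /= e0 eC] : nbhs y C by exact: open_nbhs_nbhs.
  exists e => //; split=> //; apply: contrapT => /not_orP[/existsNP[x1]] /=.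
  move=> /not_implyP[Tx1 Ux1] /existsNP[x2] /not_implyP[Tx2 Vx2].
  have [|||x [[Tx Ux] Vx]] := connected_cover _ _ _ _ (cTb y e e0) oU oV.
  - by move=> x Tx; apply: TUV; apply: eC.
  - by exists x2; split=> //; case: (TUV x2) => //; apply: eC.
  - by exists x1; split=> //; case: (TUV x1) => //; apply: eC.
  - by apply: TUV0; exists x; do !split => //; apply: eC.
pose side W := [set y | exists2 e : R, 0 < e & ball y e `<=` C /\
  T @^-1` ball y e `<=` W].
have oside W : open (side W).
  rewrite openE => y [e e0 [eC eW]]; apply/nbhs_ballP.
  exists (e / 2); first by rewrite /= divr_gt0.
  move=> z yz; have sub : ball z (e / 2) `<=` ball y e.
    by move=> t zt; rewrite (splitr e); exact: ball_triangle zt.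
  exists (e / 2); first by rewrite divr_gt0.
  by split=> [t /sub/eC//|t /sub/eW].
have [|||y [[Cy [e e0 [_ eU]]] [e' e'0 [eC' eV]]]] :=
  connected_cover _ _ _ _ cC (oside U) (oside V).
- by move=> y /sides[e e0 [eC [|]]]; [left|right]; exists e.
- have [x [Cx Ux]] := TU; exists (T x); split=> //.
  have [e e0 [eC [|eV]]] := sides _ Cx; first by exists e.
  by exfalso; apply: TUV0; exists x; do !split=> //; apply: eV; exact: ballxx.
- have [x [Cx Vx]] := TV; exists (T x); split=> //.
  have [e e0 [eC [eU|]]] := sides _ Cx; last by exists e.
  by exfalso; apply: TUV0; exists x; do !split=> //; apply: eU; exact: ballxx.
(* Any point over the smaller of the two balls lies in both [U] and [V]. *)
- have [x Tx] := Tb0 y (Num.min e e') ltac:(by rewrite lt_min e0).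
  apply: TUV0; exists x; split; [split|].
  + by apply: eC'; apply: le_ball Tx; rewrite ge_min lexx orbT.
  + by apply: eU; apply: le_ball Tx; rewrite ge_min lexx.
  + by apply: eV; apply: le_ball Tx; rewrite ge_min lexx orbT.
Qed.

(** * A minimax principle for functions concave in a real parameter *)

Lemma minimax_concave_connected (R : realType) (X : topologicalType)
    (f : X -> R -> R) (a b r : R) :
  a < b ->
  (forall l, a <= l -> l <= b -> continuous (f ^~ l)) ->
  (forall x, {within `[a, b], continuous (f x)}) ->
  (forall x, @concave_on R R^o `[a, b] (f x)) ->
  (forall l, a < l -> l < b -> connected [set x | f x l < r]) ->
  (forall l, a < l -> l < b -> exists x, f x l < r) ->
  (exists x, f x a < r) -> (exists x, f x b < r) ->
  exists x, forall l, a <= l -> l <= b -> f x l <= r.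
Proof.
move=> ltab cfx cfl concf conn ne [xa fa] [xb fb].
apply: contrapT => /forallNP noX.
have big x : exists l, [/\ a <= l, l <= b & r < f x l].
  have /existsNP[l /not_implyP[al /not_implyP[lb /negP]]] := noX x.
  by rewrite -ltNge => rl; exists l.
pose I x l := [/\ a <= l, l <= b & r < f x l].
pose lo l := [set x | exists2 m, I x m & m < l].
pose hi l := [set x | exists2 m, I x m & l < m].
pose S l := [set x | f x l < r].
have oI m : open [set x | I x m].
  have [/andP[am mb]|nm] := boolP (a <= m <= b); last first.
    rewrite (_ : [set _ | _] = set0); first exact: open0.
    by apply/seteqP; split=> x // -[am mb]; rewrite am mb in nm.
  rewrite (_ : [set _ | _] = (f ^~ m) @^-1` `]r, +oo[%classic).
    by apply: open_comp; [move=> x _; exact: cfx|exact: interval_open].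
  apply/seteqP; split=> x /=; rewrite in_itv /= andbT; first by case.
  by split.
have olo l : open (lo l).
  rewrite openE => x [m Im ml].
  by apply: filterS (open_nbhs_nbhs (conj (oI m) Im)) => y Iy; exists m.
have ohi l : open (hi l).
  rewrite openE => x [m Im ml].
  by apply: filterS (open_nbhs_nbhs (conj (oI m) Im)) => y Iy; exists m.
have cover l : S l `<=` lo l `|` hi l.
  move=> x fxl; have [m Im] := big x.
  have [ml|lm|lm] := ltgtP m l; [by left; exists m|by right; exists m|].
  by move: Im => [_ _]; rewrite lm => /lt_trans/(_ fxl); rewrite ltxx.
(* Values above [r] on both sides of [l] would put [f x l] above [r] by concavity; [t] is the weight
   of [m] in [l = t m + (1 - t) n]. *)
have disj l x : S l x -> lo l x -> hi l x -> False.
  move=> fxl [m [am mb rm] ml] [n [an nb rn] ln].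
  have mn : m < n by exact: lt_trans ln.
  pose t := (n - l) / (n - m).
  have nm0 : 0 < n - m by rewrite subr_gt0.
  have t0 : 0 <= t by rewrite divr_ge0// ?subr_ge0 ltW.
  have t1 : t <= 1 by rewrite ler_pdivrMr// mul1r lerD2l lerN2 ltW.
  have := (concave_onP R R^o _ _).1 (concf x) m n t _ _ t0 t1.
  rewrite /= !in_itv /= am mb an nb => /(_ erefl erefl).
  have -> : t *: (m : R^o) + (1 - t) *: (n : R^o) = l.
    by rewrite /GRing.scale /= /t; field; rewrite gt_eqF.
  move: fxl; rewrite /S /=; nra.
(* Interior parameters are classified by the side on which their sublevel set has a point. A witness
   survives small changes of [l], so both classes are open. *)
pose LO := [set l | (l \in `]a, b[) /\ exists x, S l x /\ lo l x].
pose HI := [set l | (l \in `]a, b[) /\ exists x, S l x /\ hi l x].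
have cflx x := (continuous_within_itvP (f x) ltab).1 (cfl x).
have nS l x : l \in `]a, b[ -> S l x -> \forall m \near l, S m x.
  move=> lab fxl; have [+ _ _] := cflx x => /(_ _ lab) /cvgr_lt; exact.
have nI l : l \in `]a, b[ -> \forall m \near l, (m \in `]a, b[).
  by move=> lab; apply: near_in_itvoo.
have oLO : open LO.
  rewrite openE => l [lab [x [Slx [m Im ml]]]].
  rewrite /interior; near=> l'; split; first by near: l'; exact: nI.
  exists x; split; first by near: l'; exact: nS.
  by exists m => //; near: l'; exact: lt_nbhsr.
have oHI : open HI.
  rewrite openE => l [lab [x [Slx [m Im ml]]]].
  rewrite /interior; near=> l'; split; first by near: l'; exact: nI.
  exists x; split; first by near: l'; exact: nS.
  by exists m => //; near: l'; exact: lt_nbhsl.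
have cab : connected (`]a, b[ : set R).
  by apply/connected_intervalP; exact: interval_is_interval.
have [|||l [[_ [lab [x [Sx lox]]]] [_ [y [Sy hiy]]]]] :=
    connected_cover _ _ _ _ cab oLO oHI.
- move=> l lab; have := lab; rewrite /= in_itv /= => /andP[al lb].
  have [x Sx] := ne l al lb.
  by have [lox|hix] := cover _ _ Sx; [left|right]; split=> //; exists x.
(* As [f xb b < r], the excess of [xb] occurs at some [m < b]; every [l] in []m, b[] close enough to
   [b] is then in [LO]. *)
- have [m Im] := big xb; have [am mb rm] := Im.
  have ltmb : m < b.
    rewrite lt_neqAle mb andbT.
    by apply: contraTneq rm => ->; rewrite -leNgt ltW.
  have [_ _ /cvgr_lt/(_ _ fb) nb] := cflx xb.
  near b^'- => l.
  have lab : l \in `]a, b[.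
    rewrite in_itv /=; apply/andP; split; near: l.
      exact: nbhs_left_gt.
    exact: nbhs_left_lt.
  exists l; split=> //; split=> //; exists xb; split; first by near: l.
  by exists m => //; near: l; exact: nbhs_left_gt.
(* The mirror image at [a] produces a point of [HI]. *)
- have [m Im] := big xa; have [am mb rm] := Im.
  have ltam : a < m.
    rewrite lt_neqAle am andbT.
    by apply: contraTneq rm => <-; rewrite -leNgt ltW.
  have [_ /cvgr_lt/(_ _ fa) na _] := cflx xa.
  near a^'+ => l.
  have lab : l \in `]a, b[.
    rewrite in_itv /=; apply/andP; split; near: l.
      exact: nbhs_right_gt.
    exact: nbhs_right_lt.
  exists l; split=> //; split=> //; exists xa; split; first by near: l.
  by exists m => //; near: l; exact: nbhs_right_lt.
(* At this common [l] both sides meet the connected sublevel set, hence share a point of it, against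
   [disj]. *)
move: lab; rewrite in_itv /= => /andP[al lb].
have [|||z [[Sz loz] hiz]] :=
    connected_cover _ _ _ _ (conn l al lb) (olo l) (ohi l).
- exact: cover.
- by exists x.
- by exists y.
exact: disj Sz loz hiz.
Unshelve. all: by end_near. Qed.

(** * Paths, Lipschitz maps and polygonal interpolation *)

(** Paths are defined on all of [R] but confined to [A] on [0, 1] only, so that globally Lipschitz
    maps can serve as paths. *)
Lemma connected_of_paths (R : realType) (X : topologicalType) (A : set X) :
  (forall x x', A x -> A x' -> exists p : R -> X,
     [/\ continuous p, p 0 = x, p 1 = x' &
         forall t, 0 <= t -> t <= 1 -> A (p t)]) ->
  connected A.
Proof.
move=> pathA; apply: connected_from_cover => U V oU oV AUV.
move=> [x [Ax Ux]] [x' [Ax' Vx']].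
have [p [cp p0 p1 pA]] := pathA x x' Ax Ax'.
have PA : p @` `[0, 1] `<=` A.
  by move=> _ [t /= + <-]; rewrite in_itv /= => /andP[t0 t1]; exact: pA.
have [||||y [[Py Uy] Vy]] := connected_cover _ (p @` `[0, 1]) U V _ oU oV.
- apply: connected_continuous_connected; first exact: segment_connected.
  exact: continuous_subspaceT.
- by move=> y /PA/AUV.
- by exists x; split=> //; exists 0; rewrite //= in_itv /= lexx ler01.
- by exists x'; split=> //; exists 1; rewrite //= in_itv /= lexx ler01.
by exists y; do !split=> //; exact: PA.
Qed.

Definition lipschitz_map (R : realType) (X Y : normedModType R) (f : X -> Y) :=
  exists2 C : R, 0 <= C & forall x x', `|f x - f x'| <= C * `|x - x'|.

Arguments lipschitz_map {R X Y} f.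

Section lipschitz_map_theory.
Context {R : realType}.
Implicit Types X Y Z : normedModType R.

Lemma lipschitz_map_continuous X Y (f : X -> Y) :
  lipschitz_map f -> continuous f.
Proof.
move=> [C C0 fC] x; apply/cvgrPdist_lt => e e0.
near=> t; apply: le_lt_trans (fC _ _) _.
have : `|x - t| < e / (C + 1).
  by near: t; apply: cvgr_dist_lt; rewrite ?divr_gt0 ?ltr_wpDl.
rewrite ltr_pdivlMr ?ltr_wpDl//; apply: le_lt_trans.
by rewrite mulrC ler_wpM2l// lerDl.
Unshelve. all: by end_near. Qed.

Lemma lipschitz_mapD X Y (f g : X -> Y) :
  lipschitz_map f -> lipschitz_map g -> lipschitz_map (f \+ g).
Proof.
move=> [C C0 fC] [D D0 gD]; exists (C + D) => [|x x']; first exact: addr_ge0.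
rewrite /= opprD addrACA mulrDl (le_trans (ler_normD _ _))//.
exact: lerD.
Qed.

Lemma lipschitz_mapN X Y (f : X -> Y) :
  lipschitz_map f -> lipschitz_map (\- f).
Proof.
by move=> [C C0 fC]; exists C => // x x'; rewrite /= -opprD normrN.
Qed.

Lemma lipschitz_map_comp X Y Z (f : Y -> Z) (g : X -> Y) :
  lipschitz_map f -> lipschitz_map g -> lipschitz_map (f \o g).
Proof.
move=> [C C0 fC] [D D0 gD]; exists (C * D) => [|x x']; first exact: mulr_ge0.
by rewrite /= (le_trans (fC _ _))// -mulrA ler_wpM2l.
Qed.

Lemma lipschitz_map_line X (x y : X) :
  lipschitz_map (X := R^o) (fun t : R => (1 - t) *: x + t *: y).
Proof.
exists `|y - x| => // s t.
have -> : (1 - s) *: x + s *: y - ((1 - t) *: x + t *: y) = (s - t) *: (y - x).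
  rewrite opprD addrACA -!scalerBl scalerBr [X in X *: x](_ : _ = t - s);
    last first.
    by ring.
  by rewrite addrC -[t - s]opprB scaleNr.
by rewrite normrZ mulrC.
Qed.

End lipschitz_map_theory.

Lemma norm_convex_le (R : realType) (X : normedModType R) (x y : X) (s B : R) :
  0 <= s -> s <= 1 -> `|x| <= B -> `|y| <= B -> `|(1 - s) *: x + s *: y| <= B.
Proof.
move=> s0 s1 xB yB; rewrite (le_trans (ler_normD _ _))// !normrZ.
rewrite !ger0_norm ?subr_ge0//.
have : 0 <= (1 - s) * (B - `|x|) by rewrite mulr_ge0 ?subr_ge0.
have : 0 <= s * (B - `|y|) by rewrite mulr_ge0 ?subr_ge0.
lra.
Qed.

(** The retraction of the line onto [0, 1], used as a ramp that switches on one more edge of a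
    polygonal path. *)
Definition clip01 (R : realType) (t : R) := Num.max 0 (Num.min 1 t).

Lemma clip01_lipschitz (R : realType) (s t : R) :
  `|clip01 R s - clip01 R t| <= `|s - t|.
Proof.
have := ler_norm (s - t); have := ler_norm (t - s); rewrite distrC => ? ?.
rewrite /clip01 ler_norml /Num.max /Num.min.
case: (ltP 1 s) => ?; case: (ltP 1 t) => ?; do ! case: ltP => ?.
all: by apply/andP; split; lra.
Qed.

(** Induction on [N]: the next edge is added by a ramp equal to 0 before time [N h] and to 1 after
    [(N + 1) h]. The last clause keeps what later estimates use: [z t] is a convex combination of
    two vertices whose times are within [h] of [t]. *)
Lemma polygonal_path (R : realType) (X : normedModType R) (u : nat -> X)
    (h : R) (N : nat) :
  0 < h -> exists2 z : R -> X, lipschitz_map (X := R^o) z &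
  [/\ z 0 = u 0%N, forall t, N%:R * h <= t -> z t = u N &
  forall t, 0 <= t -> t <= N%:R * h -> exists i j s,
    [/\ (i <= N)%N, (j <= N)%N, `|t - i%:R * h| <= h, `|t - j%:R * h| <= h &
        [/\ 0 <= s, s <= 1 & z t = (1 - s) *: u i + s *: u j]]].
Proof.
move=> h0; elim: N => [|N [z zlip [z0 zN zconv]]].
  exists (fun=> u 0%N); first by exists 0 => // s t; rewrite subrr normr0 mul0r.
  split=> // t t0 t0'; exists 0%N, 0%N, 0; split=> //.
  - by rewrite mul0r subr0 ger0_norm//; lra.
  - by rewrite mul0r subr0 ger0_norm//; lra.
  - by rewrite subr0 scale1r scale0r addr0.
pose c (t : R) := clip01 R ((t - N%:R * h) / h).
have N0 : 0 <= N%:R * h by rewrite mulr_ge0// ltW.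
have NS : N.+1%:R * h = N%:R * h + h by rewrite -natr1 mulrDl mul1r.
have c0 t : t <= N%:R * h -> c t = 0.
  move=> tN; rewrite /c /clip01 max_l// ge_min orbC.
  by rewrite pmulr_lle0 ?invr_gt0// subr_le0 tN.
have c1 t : N.+1%:R * h <= t -> c t = 1.
  move=> tN; rewrite /c /clip01 min_l ?max_r//.
  by rewrite ler_pdivlMr// mul1r; lra.
exists (fun t => z t + c t *: (u N.+1 - u N)).
  apply: (@lipschitz_mapD _ R^o) => //.
  exists (`|u N.+1 - u N| / h) => [|s t]; first by rewrite divr_ge0// ltW.
  rewrite -scalerBl normrZ mulrC -mulrA ler_wpM2l//.
  apply: (le_trans (clip01_lipschitz _ _ _)).
  rewrite -mulrBl normrM (gtr0_norm (x := h^-1)) ?invr_gt0// mulrC.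
  by rewrite opprB addrA subrK.
split.
- by rewrite c0// scale0r addr0.
- move=> t tN; rewrite c1// zN; last by lra.
  by rewrite scale1r addrC subrK.
move=> t t0 tN; have [tltN|NleT] := leP t (N%:R * h).
  have [i [j [s [iN jN ti tj [s0 s1 ->]]]]] := zconv t t0 tltN.
  exists i, j, s; split=> //; [exact: leqW|exact: leqW|split=> //].
  by rewrite c0// scale0r addr0.
exists N, N.+1, ((t - N%:R * h) / h); split=> //.
- by rewrite ger0_norm; lra.
- by rewrite ler0_norm; lra.
have s0 : 0 <= (t - N%:R * h) / h by rewrite divr_ge0//; lra.
have s1 : (t - N%:R * h) / h <= 1 by rewrite ler_pdivrMr//; lra.
split=> //; rewrite zN 1?ltW// /c.
have -> : clip01 R ((t - N%:R * h) / h) = (t - N%:R * h) / h.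
  by rewrite /clip01 min_r// max_r.
by rewrite scalerBr scalerBl scale1r [RHS]addrAC -addrA.
Qed.

(** * Lipschitz perturbations of a linear map with a bounded right inverse *)

Lemma geometric_lt (R : realType) (q D e : R) : 0 <= q -> q < 1 -> 0 < e ->
  exists n, q ^+ n * D < e.
Proof.
move=> q0 q1 e0.
have : (fun n => D * q ^+ n) @ \oo --> (0 : R).
  by apply: cvg_geometric; rewrite ger0_norm.
move=> /cvgr_lt/(_ _ e0)[n _ /(_ n (leqnn n)) /= nD].
by exists n; rewrite mulrC.
Qed.

Section lift.
Context {R : realType} {X Y : normedModType R} (Phi : {linear X -> Y}).
Context (g : Y -> X) (K : R).
Hypotheses (K0 : 0 <= K) (gP : forall y, Phi (g y) = y)
  (gK : forall y, `|g y| <= K * `|y|).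

(** [g] carries no continuity, so [g \o w] may fail to be a path. Only the values of [w] at nodes
    are lifted, and the lifts are joined by segments; by linearity [Phi (z t)] is a convex
    combination of values of [w] at times near [t]. *)
Lemma approximate_path_lift (w : R -> Y) (D e : R) :
  lipschitz_map (X := R^o) w -> 0 < e ->
  (forall t, 0 <= t -> t <= 1 -> `|w t| <= D) ->
  exists2 z : R -> X, lipschitz_map (X := R^o) z &
  [/\ z 0 = g (w 0), z 1 = g (w 1) &
  forall t, 0 <= t -> t <= 1 -> `|z t| <= K * D /\ `|w t - Phi (z t)| <= e].
Proof.
move=> [C C0 wC] e0 wD.
(* The mesh [1 / N] is so fine that [w], with Lipschitz constant [C], moves by at most [e] over one
   step. *)
pose N := (Num.bound (C / e)).+1.
pose h : R := N%:R^-1.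
have h0 : 0 < h by rewrite invr_gt0.
have Nh : N%:R * h = 1 by rewrite mulfV ?pnatr_eq0.
have Ch : C * h <= e.
  rewrite ler_pdivrMr// mulrC -ler_pdivrMr// ltW//.
  apply: lt_trans (archi_boundP _) _; first by rewrite divr_ge0// ltW.
  by rewrite ltr_nat.
have [z zlip [z0 z1 zt]] :=
  polygonal_path R X (fun i => g (w (i%:R * h))) h N h0.
exists z => //; split.
- by rewrite z0 mul0r.
- by rewrite z1 Nh.
move=> t t0 t1; have [|i [j [s [iN jN ti tj [s0 s1 ->]]]]] := zt t t0.
  by rewrite Nh.
have node (n : nat) : (n <= N)%N -> 0 <= n%:R * h /\ n%:R * h <= 1.
  move=> nN; split; first exact: mulr_ge0 (ler0n _ _) (ltW h0).
  by rewrite -[leRHS]Nh ler_pM2r ?ler_nat.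
split.
  have gD i' : (i' <= N)%N -> `|g (w (i'%:R * h))| <= K * D.
    by move=> /node[a b]; rewrite (le_trans (gK _))// ler_wpM2l// wD.
  by apply: norm_convex_le; rewrite ?gD.
rewrite linearD !linearZ /= !gP.
have -> (a b : Y) : w t - ((1 - s) *: a + s *: b) =
    (1 - s) *: (w t - a) + s *: (w t - b).
  by rewrite !scalerBr addrACA -scalerDl subrK scale1r opprD.
have we i' : `|t - i'%:R * h| <= h -> `|w t - w (i'%:R * h)| <= e.
  by move=> ti'; rewrite (le_trans (wC _ _))// (le_trans _ Ch)// ler_wpM2l.
by apply: norm_convex_le; rewrite ?we.
Qed.

Context (M : X -> Y) (k : R).
Hypotheses (Phi_continuous : continuous Phi) (k0 : 0 <= k) (kK : k * K < 1)
  (Mk : forall x x', `|M x - M x'| <= k * `|x - x'|).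

Let T x := Phi x + M x.

(** Adding [g (y - T x)] to [x] cancels the residual through [Phi] and leaves only the change of
    [M], at most [k * K] times the old residual. *)
Lemma lipschitz_perturbation_dense (y : Y) (e : R) :
  0 < e -> exists x, `|y - T x| < e.
Proof.
move=> e0; have kK0 : 0 <= k * K by exact: mulr_ge0.
have [n ne] := geometric_lt _ _ (`|y - T 0|) _ kK0 kK e0.
suff [x xn] : exists x, `|y - T x| <= (k * K) ^+ n * `|y - T 0|.
  by exists x; exact: le_lt_trans ne.
elim: n {ne} => [|n [x xn]]; first by exists 0; rewrite expr0 mul1r.
exists (x + g (y - T x)).
have -> : y - T (x + g (y - T x)) = M x - M (x + g (y - T x)).
  rewrite {1}/T linearD gP.
  have -> : Phi x + (y - T x) = y - M x.
    by rewrite /T opprD addrCA [Phi x + _]addrA subrr add0r.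
  by rewrite opprD opprB addrA addrCA subrr addr0.
rewrite (le_trans (Mk _ _))// opprD addrA subrr sub0r normrN.
rewrite exprS -!mulrA ler_wpM2l// (le_trans (gK _))//.
by rewrite ler_wpM2l.
Qed.

Lemma lipschitz_perturbation_lipschitz : lipschitz_map T.
Proof.
apply: lipschitz_mapD; last by exists k.
have [C C0 PhiC] := linear_lipschitz Phi_continuous.
by exists C; rewrite ?ltW// => x x'; rewrite -linearB.
Qed.

(** The same iteration runs on whole paths from [x0] to [x1], starting with the segment. The
    residual vanishes at both ends and [g 0 = 0], so the corrections keep the endpoints fixed. *)
Lemma lipschitz_perturbation_path (x0 x1 : X) (e : R) :
  0 < e -> exists2 p : R -> X, lipschitz_map (X := R^o) p &
  [/\ p 0 = x0, p 1 = x1 & forall t, 0 <= t -> t <= 1 ->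
      `|(1 - t) *: T x0 + t *: T x1 - T (p t)| < e].
Proof.
move=> e0; pose v (t : R) := (1 - t) *: T x0 + t *: T x1.
have v0 : v 0 = T x0 by rewrite /v subr0 scale1r scale0r addr0.
have v1 : v 1 = T x1 by rewrite /v subrr scale1r scale0r add0r.
have resid_lip p : lipschitz_map (X := R^o) p ->
    lipschitz_map (X := R^o) (fun t => v t - T (p t)).
  move=> plip; apply: lipschitz_mapD; first exact: lipschitz_map_line.
  apply: lipschitz_mapN; apply: (@lipschitz_map_comp _ R^o) => //.
  exact: lipschitz_perturbation_lipschitz.
pose p0 (t : R) := (1 - t) *: x0 + t *: x1.
have p0lip : lipschitz_map (X := R^o) p0 by exact: lipschitz_map_line.
have p00 : p0 0 = x0 by rewrite /p0 subr0 scale1r scale0r addr0.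
have p01 : p0 1 = x1 by rewrite /p0 subrr scale1r scale0r add0r.
have [C C0 DC] := resid_lip _ p0lip.
(* The midpoint of [k * K] and 1: the gap [q - k * K] absorbs the error of the approximate lift. *)
pose q := (1 + k * K) / 2.
have kK0 : 0 <= k * K by exact: mulr_ge0.
have q0 : 0 < q by rewrite /q; lra.
have q1 : q < 1 by rewrite /q; have := kK; lra.
(* [C + 1] instead of [C] keeps the bound positive, since the lift asks for a positive tolerance. *)
have [n ne] := geometric_lt _ _ (C + 1) _ (ltW q0) q1 e0.
suff [p plip [pp0 pp1 pn]] : exists2 p : R -> X, lipschitz_map (X := R^o) p &
  [/\ p 0 = x0, p 1 = x1 & forall t, 0 <= t -> t <= 1 ->
      `|v t - T (p t)| <= q ^+ n * (C + 1)].
  by exists p => //; split=> // t t0 t1; apply: le_lt_trans ne; exact: pn.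
elim: n {ne} => [|n [p plip [pp0 pp1 pn]]].
  exists p0 => //; split=> // t t0 t1; rewrite expr0 mul1r.
  (* The initial residual is 0 at time 0, so its Lipschitz constant [C] bounds it on [0, 1]. *)
  have := DC t 0; rewrite p00 v0 subrr !subr0 ger0_norm// => /le_trans; apply.
  by rewrite ler_wpDr// ler_piMr.
pose E := q ^+ n * (C + 1).
have E0 : 0 < E by rewrite mulr_gt0 ?exprn_gt0 ?ltr_wpDl.
have eta0 : 0 < (1 - k * K) / 2 * E by rewrite mulr_gt0//; have := kK; lra.
have [z zlip [z0 z1 zE]] :=
  approximate_path_lift _ _ _ (resid_lip _ plip) eta0 pn.
have g0 : g 0 = 0.
  by apply/eqP; rewrite -normr_le0 (le_trans (gK _))// normr0 mulr0.
exists (p \+ z); first exact: lipschitz_mapD.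
split=> [||t t0 t1] /=.
- by rewrite z0 pp0 v0 subrr g0 addr0.
- by rewrite z1 pp1 v1 subrr g0 addr0.
have [zK zPhi] := zE t t0 t1.
have -> : v t - T (p t + z t) =
    (v t - T (p t) - Phi (z t)) + (M (p t) - M (p t + z t)).
  rewrite /T (linearD Phi) !opprD !addrA; congr (_ - _).
  by rewrite [RHS]addrAC subrK.
rewrite (le_trans (ler_normD _ _))// exprS -mulrA -/E /q.
have : `|M (p t) - M (p t + z t)| <= k * K * E.
  rewrite (le_trans (Mk _ _))// opprD addrA subrr sub0r normrN -mulrA.
  by rewrite ler_wpM2l.
move: zPhi; lra.
Qed.

(** By convexity the segment from [T x] to [T x'] stays in the ball with room [e - d] to spare, so a
    path whose image follows it more closely than that remains in the preimage. *)
Lemma lipschitz_perturbation_connected (y : Y) (e : R) :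
  0 < e -> connected (T @^-1` ball y e).
Proof.
move=> e0; apply: (connected_of_paths R) => x x' /= yx yx'.
move: yx yx'; rewrite -ball_normE /= => yx yx'.
pose d := Num.max `|y - T x| `|y - T x'|.
have de : 0 < e - d by rewrite subr_gt0 gt_max yx.
have [p plip [p0 p1 pd]] := lipschitz_perturbation_path x x' _ de.
exists p; split=> //; first exact: lipschitz_map_continuous plip.
move=> t t0 t1; have {}pd := pd t t0 t1.
rewrite -(subrK ((1 - t) *: T x + t *: T x') y) -addrA.
rewrite (le_lt_trans (ler_normD _ _))// -(subrK d e) [ltRHS]addrC ler_ltD//.
have -> : y - ((1 - t) *: T x + t *: T x') =
    (1 - t) *: (y - T x) + t *: (y - T x').
  by rewrite !scalerBr addrACA -scalerDl subrK scale1r opprD.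
by apply: norm_convex_le; rewrite // /d le_max lexx ?orbT.
Qed.

End lift.

(** * The constant [alpha] as a bound for preimages *)

Section alpha.
Context {R : realType} {X Y : normedModType R} (Phi : {linear X -> Y}).

Lemma dist0_ge0 (A : set X) : (0 <= dist0 A)%E.
Proof. by apply: le_ereal_inf_tmp => _ [x _ <-]; rewrite lee_fin. Qed.

Lemma alpha_ge0 : 0 <= alpha Phi.
Proof.
apply: fine_ge0; apply: le_ereal_sup_tmp.
exists (dist0 (Phi @^-1` [set 0])); last exact: dist0_ge0.
by exists 0; rewrite //= normr0.
Qed.

(** [K] exceeds the supremum, so the unit vector along a nonzero [y] has a preimage of norm below
    [K], which is then rescaled. *)
Lemma alpha_lift (K : R) (y : Y) : 0 < alpha Phi -> alpha Phi < K ->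
  exists x, Phi x = y /\ `|x| <= K * `|y|.
Proof.
move=> alpha0 alphaK.
(* [fine] sends infinite values to 0, so a positive [alpha Phi] is the true value of
   [alphaE Phi]. *)
have alphaE_fin : alphaE Phi = (alpha Phi)%:E.
  rewrite /alpha fineK//; move: alpha0; rewrite /alpha.
  by case: (alphaE _) => //=; rewrite ltxx.
have [->|y0] := eqVneq y 0.
  by exists 0; rewrite linear0 !normr0 mulr0.
have ny : 0 < `|y| by rewrite normr_gt0.
have : (dist0 (Phi @^-1` [set `|y|^-1 *: y]) < K%:E)%E.
  apply: (@le_lt_trans _ _ (alphaE Phi)); last by rewrite alphaE_fin lte_fin.
  apply: ereal_sup_ubound; exists (`|y|^-1 *: y) => //=.
  by rewrite normrZ normfV normr_id mulVf ?gt_eqF.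
move=> /ereal_inf_lt[_ [x /= xy <-]]; rewrite lte_fin => xK.
exists (`|y| *: x); split.
  by rewrite linearZ /= xy scalerA mulfV ?gt_eqF// scale1r.
by rewrite normrZ normr_id mulrC ler_wpM2r// ltW.
Qed.

End alpha.

(** * The pencil of maps [T l] *)

Section pencil.
Context {R : realType} {X Y : normedModType R}.
Context (Phi : {linear X -> Y}) (Psi : X -> Y) (L : R).
Hypotheses (Phi_continuous : continuous Phi)
  (Phi_surjective : set_surj [set: X] [set: Y] Phi)
  (L0 : 0 <= L) (Psi_lipschitz : L.-lipschitz Psi).

Lemma Psi_lipschitzE (x x' : X) : `|Psi x - Psi x'| <= L * `|x - x'|.
Proof. exact: (Psi_lipschitz (x, x')). Qed.

Let T (l : R) (x : X) := Phi x + (l / (alpha Phi * L)) *: Psi x.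

Lemma pencil_continuous (l : R) : continuous (T l).
Proof.
move=> x; apply: cvgD; first exact: Phi_continuous.
apply: cvgZl_tmp; apply: lipschitz_map_continuous.
by exists L => // ? ?; exact: Psi_lipschitzE.
Qed.

Lemma pencil_ball (l : R) (y : Y) (e : R) : -1 < l -> l < 1 -> 0 < e ->
  T l @^-1` ball y e !=set0 /\ connected (T l @^-1` ball y e).
Proof.
move=> l_gt l_lt e0.
have nl : `|l| < 1 by rewrite ltr_norml l_gt.
(* The coefficient vanishes when [l = 0] and, by the convention on division, when
   [alpha Phi * L = 0]. *)
have [mu0|mu_neq0] := eqVneq (l / (alpha Phi * L)) 0.
  have -> : T l = Phi by apply/funext => x; rewrite /T mu0 scale0r addr0.
  have [x _ xy] := Phi_surjective y Logic.I.
  split; first by exists x; rewrite /preimage /= xy; exact: ballxx.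
  apply: (connected_of_paths R) => x1 x2 /=; rewrite -ball_normE /= => b1 b2.
  exists (fun t => (1 - t) *: x1 + t *: x2); split.
  - exact: (@lipschitz_map_continuous R R^o X _ (lipschitz_map_line X x1 x2)).
  - by rewrite subr0 scale1r scale0r addr0.
  - by rewrite subrr scale1r scale0r add0r.
  move=> t t0 t1; rewrite linearD !linearZ /=.
  have -> : y - ((1 - t) *: Phi x1 + t *: Phi x2) =
      (1 - t) *: (y - Phi x1) + t *: (y - Phi x2).
    by rewrite !scalerBr addrACA -scalerDl subrK scale1r opprD.
  apply: (@le_lt_trans _ _ (Num.max `|y - Phi x1| `|y - Phi x2|)).
    by apply: norm_convex_le; rewrite // le_max lexx ?orbT.
  by rewrite gt_max b1.
move: mu_neq0; rewrite mulf_eq0 invr_eq0 mulf_eq0 !negb_or.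
move=> /and3P[l_neq0 a_neq0 L_neq0].
have alpha_gt0 : 0 < alpha Phi by rewrite lt_neqAle eq_sym a_neq0 alpha_ge0.
have L_gt0 : 0 < L by rewrite lt_neqAle eq_sym L_neq0.
(* This is [alpha Phi] over the mean of 1 and [|l|]: it exceeds [alpha Phi], as lifting demands, yet
   keeps the contraction factor [2 |l| / (1 + |l|)] below 1. *)
pose K := 2 * alpha Phi / (1 + `|l|).
have nl0 : 0 <= `|l| by [].
have alphaK : alpha Phi < K.
  by rewrite ltr_pdivlMr; nra.
have [g gP] := choice (fun y => alpha_lift Phi K y alpha_gt0 alphaK).
pose mu := l / (alpha Phi * L).
have k0 : 0 <= `|mu| * L by rewrite mulr_ge0.
have kK : `|mu| * L * K < 1.
  have -> : `|mu| * L * K = 2 * `|l| / (1 + `|l|).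
    rewrite /mu normrM normfV (gtr0_norm (mulr_gt0 alpha_gt0 L_gt0)) /K.
    by field; rewrite L_neq0 a_neq0 gt_eqF//; lra.
  by rewrite ltr_pdivrMr; lra.
have K0 : 0 <= K by rewrite (le_trans (alpha_ge0 Phi))// ltW.
have Mk x x' : `|mu *: Psi x - mu *: Psi x'| <= `|mu| * L * `|x - x'|.
  by rewrite -scalerBr normrZ -mulrA ler_wpM2l// Psi_lipschitzE.
split.
  have [x yx] := lipschitz_perturbation_dense Phi g K K0 (fun y => (gP y).1)
    (fun y => (gP y).2) (fun x => mu *: Psi x) _ k0 kK Mk y e e0.
  by exists x; rewrite /preimage /= -ball_normE.
exact: (lipschitz_perturbation_connected Phi g K K0 (fun y => (gP y).1)
    (fun y => (gP y).2) (fun x => mu *: Psi x) _ Phi_continuous k0 kK Mk y e e0).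
Qed.

End pencil.

(** * The minimax equality in the extended reals *)

(** Testing against real levels above [y] also covers [y = -oo], where [x] is pushed below every
    real. *)
Lemma lee_of_real_upper (R : realType) (x y : \bar R) :
  (forall r : R, (y < r%:E)%E -> (x <= r%:E)%E) -> (x <= y)%E.
Proof.
move=> xr; case: y xr => [y||] xr; last 2 first.
- exact: leey.
- case: x xr => // [x /(_ (x - 1) (ltNyr _))|/(_ 0 (ltNyr _))//].
  by move=> xx; exfalso; move: xx; rewrite lee_fin; lra.
apply/lee_addgt0Pr => e e0; rewrite -EFinD; apply: xr.
by rewrite lte_fin ltrDl.
Qed.

Theorem theorem1p1 (R : realType) (X Y : completeNormedModType R)
    (Phi : {linear X -> Y}) (Psi : X -> Y) (L : R) (phi : Y -> R) (a b : R)
    (Phi_continuous : continuous Phi)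
    (Phi_surjective : set_surj [set: X] [set: Y] Phi)
    (Psi_nonconstant : nonconstant Psi)
    (Psi_lipschitz : is_lipschitz_constant Psi L)
    (phi_nonconstant : nonconstant phi)
    (phi_continuous : continuous phi)
    (phi_concave : concave_on [set: Y] phi)
    (phi_inf_connected : inf_connected phi)
    (ge_a_N1 : -1 <= a) (le_a_b : a <= b) (le_b_1 : b <= 1) :
  forall gamma : R -> R,
    {within `[a, b], continuous gamma} ->
    @concave_on R R^o `[a, b] gamma ->
    Order.max
      (ereal_inf [set (phi (Phi x + (a / (alpha Phi * L)) *: Psi x))%:E
                 | x in [set: X]] + (gamma a)%:E)%E
      (ereal_inf [set (phi (Phi x + (b / (alpha Phi * L)) *: Psi x))%:E
                 | x in [set: X]] + (gamma b)%:E)%E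
    = ereal_inf
        [set ereal_sup
          [set (phi (Phi x + (lambda / (alpha Phi * L)) *: Psi x)
                + gamma lambda)%:E
          | lambda in `[a, b]]
        | x in [set: X]].
Proof.
move=> gamma gamma_cont gamma_concave.
have [L0 Psi_lip _] := Psi_lipschitz.
pose T l x := Phi x + (l / (alpha Phi * L)) *: Psi x.
pose f x l := phi (T l x) + gamma l.
have aab : `[a, b]%classic a by rewrite /= in_itv /= lexx.
have bab : `[a, b]%classic b by rewrite /= in_itv /= lexx andbT.
apply/eqP; rewrite eq_le; apply/andP; split.
  (* The easy half: both endpoints are among the parameters of the supremum. *)
  have end_le l : `[a, b]%classic l ->
      (ereal_inf [set (phi (T l x))%:E | x in [set: X]] + (gamma l)%:E <=
      ereal_inf [set ereal_sup [set (f x l)%:E | l in `[a, b]] | x in [set: X]])%E.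
    move=> lab; apply: le_ereal_inf_tmp => _ [x _ <-].
    apply: le_ereal_sup_tmp; exists (f x l)%:E; first by exists l.
    rewrite /f EFinD leeD2r//.
    by apply: ereal_inf_lbound; exists x.
  by rewrite ge_max !end_le.
apply: lee_of_real_upper => r; rewrite gt_max => /andP[].
have end_lt l : (ereal_inf [set (phi (T l x))%:E | x in [set: X]]
    + (gamma l)%:E < r%:E)%E -> exists x, f x l < r.
  rewrite -lteBrDr// => /ereal_inf_lt[_ [x _ <-]].
  by rewrite -EFinB lte_fin ltrBrDr => fxr; exists x.
move=> /end_lt fa /end_lt fb.
suff [x fx] : exists x, forall l, a <= l -> l <= b -> f x l <= r.
  apply: ge_ereal_inf; exists (ereal_sup [set (f x l)%:E | l in `[a, b]]).
    by exists x.
  apply: ge_ereal_sup => _ [l /= + <-]; rewrite in_itv /= => /andP[al lb].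
  by rewrite lee_fin fx.
(* A degenerate interval has a single parameter, for which [fa] already gives the point. *)
have [ab|ba] := ltP a b; last first.
  have [x fx] := fa; exists x => l al lb.
  have -> : l = a by apply/eqP; rewrite eq_le al (le_trans lb ba).
  exact: ltW.
have T_continuous l : continuous (T l).
  exact: (pencil_continuous Phi Psi L).
have T_ball l y (e : R) : a < l -> l < b -> 0 < e ->
    T l @^-1` ball y e !=set0 /\ connected (T l @^-1` ball y e).
  move=> al lb; apply: pencil_ball => //.
    exact: le_lt_trans al.
  exact: lt_le_trans le_b_1.
have sub_open s : open (phi @^-1` `]-oo, s[).
  by apply: open_comp => [y _|]; [exact: phi_continuous|exact: interval_open].
have sub_eq l : [set x | f x l < r] = T l @^-1` (phi @^-1` `]-oo, (r - gamma l)[).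
  by apply/seteqP; split=> x; rewrite /f /= in_itv /= ltrBrDr.
apply: (minimax_concave_connected R X f a b r ab _ _ _ _ _ fa fb).
- move=> l _ _ x; apply: cvgD; last exact: cvg_cst.
  by apply: continuous_comp; [exact: T_continuous|exact: phi_continuous].
- move=> x l; apply: cvgD; last exact: gamma_cont.
  apply: continuous_subspaceT => {}l.
  apply: (@continuous_comp _ _ _ (T ^~ x) phi); last exact: phi_continuous.
  apply: cvgD; first exact: cvg_cst.
  by apply: cvgZr_tmp; apply: cvgMr_tmp; exact: cvg_id.
- move=> x; apply/concave_onP => m n t mab nab t0 t1.
  (* [T] is affine in its parameter, so the concavity of [phi] passes to [f x]. *)
  have TE : T (t * m + (1 - t) * n) x = t *: T m x + (1 - t) *: T n x.
    rewrite /T !scalerDr addrACA -[t *: Phi x + _]scalerDl.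
    rewrite [t + _]addrC subrK scale1r.
    by rewrite !scalerA -scalerDl !mulrA -mulrDl.
  have := (concave_onP _ _ _ _).1 phi_concave (T m x) (T n x) t Logic.I Logic.I
    t0 t1.
  have := (concave_onP _ _ _ _).1 gamma_concave m n t mab nab t0 t1.
  by rewrite /f -[_ *: m + _]/(t * m + (1 - t) * n) TE; lra.
- move=> l al lb; rewrite sub_eq; apply: connected_preimage_open => //.
  + by move=> y e e0; have [] := T_ball l y e al lb e0.
  + by move=> y e e0; have [] := T_ball l y e al lb e0.
- move=> l al lb.
  (* The sublevel set of [phi] is open and nonempty, so it contains a ball, and every ball meets the
     range of [T l]. *)
  have [y phiy] := concave_nonconstant_unbounded _ _ _ (r - gamma l)
    phi_concave phi_nonconstant.
  have /nbhs_ballP[e /= e0 eC] : nbhs y (phi @^-1` `]-oo, (r - gamma l)[).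
    by apply: open_nbhs_nbhs; split=> //; rewrite /= in_itv.
  have [[x /eC Tx] _] := T_ball l y e al lb e0.
  by exists x; move: Tx; rewrite /= in_itv /= ltrBrDr.
Qed.
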